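(* Let $s(x,y)$ be a convex function on $\Omega\subset\mathbb{R}^2$, let $\mathcal{V}$ be a finite set of points $(x_i,y_i)\in\Omega$, and let $s_i=s(x_i,y_i)$. The weighted Delaunay triangulation of $\mathcal{V}$ with weights $$w_i=x_i^2+y_i^2-2s_i$$ gives the same triangulation as that obtained by projecting the convex hull of the points $(x_i,y_i,s_i)\in\mathbb{R}^3$ onto the $xy$-plane.
   Context: The weighted Delaunay triangulation of points $p_i$ with weights $w_i$ is the dual graph of the power diagram, whose cell for $p_i$ is $\{p:\ |p-p_i|^2-w_i\le|p-p_j|^2-w_j\ \forall j\}$. ''Projecting the convex hull'' means: take the convex hull of the lifted points in $\mathbb{R}^3$, orient face normals outward, discard the faces whose normals have positive $z$-component (i.e. keep the lower hull), triangulate arbitrarily the remaining non-triangular faces (the same arbitrary choice being allowed for degenerate cells of the weighted Delaunay triangulation), and project orthogonally to the $xy$-plane. *)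

(* Defs.v *)
From HB Require Import structures.
From mathcomp Require Import all_boot all_order all_algebra.
From mathcomp Require Import all_classical all_reals all_analysis.

Set Implicit Arguments.
Unset Strict Implicit.
Unset Printing Implicit Defensive.

Import Order.TTheory GRing.Theory Num.Theory.
Local Open Scope classical_set_scope.
Local Open Scope ring_scope.

Section EuclideanGeometry.
Context {R : realType} {n : nat}.
Implicit Types (A P F : set 'rV[R]_n) (u v : 'rV[R]_n).

Definition dot u v : R := (u *m v^T) 0 0.

(* The Euclidean norm squared; [`|u|] would be the sup norm on row vectors. *)
Definition sqnorm u : R := dot u u.

Definition conv_hull A : set 'rV[R]_n := smallest (@convex_set R 'rV[R]_n) A.

(* [A] is nonempty and its affine span has dimension [d]: the row space of [U]
   is the smallest linear subspace containing all differences of points of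
   [A]. *)
Definition has_dim A (d : nat) : Prop :=
  A !=set0 /\
  exists2 U : 'M[R]_n, \rank U = d &
    forall W : 'M[R]_n,
      (U <= W)%MS <-> (forall x y, A x -> A y -> (x - y <= W)%MS).

(* [F] is the face of [P] in a supporting hyperplane of outward normal [u]. *)
Definition outward_normal P F u : Prop :=
  u != 0 /\ F = [set x | P x /\ forall y, P y -> dot u y <= dot u x].

End EuclideanGeometry.

(* On a convex [Omega] this is [convex_function Omega s]; in general only
   segments contained in [Omega] are constrained, so that the values of the
   total function [s] outside [Omega] play no role. *)
Definition convex_on (R : realType) (Omega : set 'rV[R]_2)
    (s : 'rV[R]_2 -> R) : Prop :=
  forall C : set 'rV[R]_2, C `<=` Omega ->
    @convex_set R 'rV[R]_2 C -> @convex_function R 'rV[R]_2 C s.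

Section Triangulations.
Context {R : realType}.
Local Notation point := 'rV[R]_2.
Implicit Types (V A P F : set point) (w s : point -> R).

(* A triangle is represented by the set of its three vertices. *)
Definition is_triangle A : Prop :=
  (exists a b c : point, A = [set a; b; c]) /\ has_dim A 2.

(* [T] is obtained by triangulating each polygon of [C], using points of [V]
   as vertices. A polygon containing no point of [V] besides its three corners
   can only be left as it is. *)
Definition triangulates V (C T : set (set point)) : Prop :=
  [/\ forall A, T A -> A `<=` V /\ is_triangle A,
      forall A B, T A -> T B ->
        conv_hull A `&` conv_hull B = conv_hull (A `&` B),
      forall A, T A -> exists2 P, C P & conv_hull A `<=` P
    & forall P, C P ->
        P = \bigcup_(A in [set A | T A /\ conv_hull A `<=` P]) conv_hull A].

Definition power_cell V w (p : point) : set point :=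
  [set q | forall p', V p' -> sqnorm (q - p) - w p <= sqnorm (q - p') - w p'].

Definition power_face V w F : Prop :=
  exists I : set point,
    [/\ I `<=` V, I !=set0 & F = \bigcap_(p in I) power_cell V w p].

Definition dual_cell V w F : set point :=
  conv_hull [set p | V p /\ F `<=` power_cell V w p].

(* The dual graph of the power diagram, drawn in the plane: its nodes
   ([d = 0]), edges ([d = 1]) and polygonal faces ([d = 2]) are dual to the
   power faces of dimension 2, 1 and 0 respectively. *)
Definition dual_cells V w (d : nat) : set (set point) :=
  [set Q | exists F,
     [/\ power_face V w F, has_dim F (2 - d) & Q = dual_cell V w F]].

Definition weighted_delaunay V w (T : set (set point)) : Prop :=
  triangulates V (dual_cells V w 2) T.

Definition lift s (p : point) : 'rV[R]_(2 + 1) := row_mx p (s p)%:M.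

Definition proj (x : 'rV[R]_(2 + 1)) : point := lsubmx x.

Definition zcoord (x : 'rV[R]_(2 + 1)) : R := rsubmx x 0 0.

Definition lower_face (P F : set 'rV[R]_(2 + 1)) (d : nat) : Prop :=
  has_dim F d /\ exists2 u, outward_normal P F u & zcoord u < 0.

Definition lower_hull_cells V s (d : nat) : set (set point) :=
  [set Q | exists2 F, lower_face (conv_hull (lift s @` V)) F d
                    & Q = proj @` F].

Definition hull_triangulation V s (T : set (set point)) : Prop :=
  triangulates V (lower_hull_cells V s 2) T.

End Triangulations.

(* Main.v *)
Require Import Defs.
From HB Require Import structures.
From mathcomp Require Import all_boot all_order all_algebra.
From mathcomp Require Import all_classical all_reals all_analysis.
From mathcomp Require Import ring lra.
Set Implicit Arguments.
Unset Strict Implicit.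
Unset Printing Implicit Defensive.
Import Order.TTheory GRing.Theory Num.Theory.
Local Open Scope classical_set_scope.
Local Open Scope ring_scope.

(** Both cell complexes are the regular subdivision of [V] with heights [s].
    Fix a slope [q] and let [M q] be the set of points of [V] at which
    [s p - dot q p] is minimal.

    On the side of the power diagram, the choice of weights gives
    [sqnorm (q - p) - w p = sqnorm q + 2 * (s p - dot q p)], so [q] lies in the
    power cell of [p] exactly when [p] belongs to [M q] ([power_cellE]). On the
    side of the hull, an outward normal with negative last coordinate is, up to
    a positive factor, [(q, -1)], and the face that it exposes is the hull of
    the lifted points that maximise [dot q p - s p], that is, of the lift of
    [M q] ([conv_hull_face], [supporting_slope]). So a point [q] of the plane
    and a lower supporting plane of slope [q] see the same points of [V], and
    it remains to match the dimensions.

    For the hull this is direct: on [M q] the lift is affine and injective, so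
    the exposed face has the dimension of [M q] ([lower_hull_cellsE]). For the
    diagram, a power face [F] consists of the slopes [q] whose [M q] contains a
    given [I]. Averaging finitely many slopes of [F] yields a slope [q0] whose
    [M q0] is as small as possible, hence equal to the set [J] of vertices dual
    to [F] ([generic_slope]). The differences of points of [F] are orthogonal
    to those of [J]; conversely [q0] can be moved a little in any direction
    orthogonal to [J] without leaving [F], because the finitely many points
    outside [J] stay strictly above the minimum. So the directions of [F] and
    [J] are orthogonal complements ([has_dim_slopes]), and a power face of
    dimension [2 - d] is dual to a set of dimension [d] ([dual_cellsE]).

    The two complexes having the same cells, they have the same
    triangulations. *)

(** * Euclidean inner product *)

Lemma dotC (R : realType) n (u v : 'rV[R]_n) : dot u v = dot v u.
Proof. by rewrite /dot -[in LHS](trmxK u) -trmx_mul mxE. Qed.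

Lemma dotDl (R : realType) n (u v x : 'rV[R]_n) :
  dot (u + v) x = dot u x + dot v x.
Proof. by rewrite /dot mulmxDl mxE. Qed.

Lemma dotZl (R : realType) n a (u x : 'rV[R]_n) : dot (a *: u) x = a * dot u x.
Proof. by rewrite /dot -scalemxAl mxE. Qed.

Lemma dotDr (R : realType) n (x u v : 'rV[R]_n) :
  dot x (u + v) = dot x u + dot x v.
Proof. by rewrite dotC dotDl !(dotC x). Qed.

Lemma dotZr (R : realType) n a (x u : 'rV[R]_n) : dot x (a *: u) = a * dot x u.
Proof. by rewrite dotC dotZl (dotC x). Qed.

Lemma dotNl (R : realType) n (u x : 'rV[R]_n) : dot (- u) x = - dot u x.
Proof. by rewrite -scaleN1r dotZl mulN1r. Qed.

Lemma dotBl (R : realType) n (u v x : 'rV[R]_n) :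
  dot (u - v) x = dot u x - dot v x.
Proof. by rewrite dotDl dotNl. Qed.

Lemma dotBr (R : realType) n (x u v : 'rV[R]_n) :
  dot x (u - v) = dot x u - dot x v.
Proof. by rewrite dotC dotBl !(dotC x). Qed.

Lemma dot_eq0 (R : realType) n (u v : 'rV[R]_n) :
  dot u v = 0 -> u *m v^T = 0.
Proof. by move=> uv0; rewrite [LHS]mx11_scalar -/(dot u v) uv0 raddf0. Qed.

(** * Convex hulls and their exposed faces *)

Lemma sub_conv_hull (R : realType) n (A : set 'rV[R]_n) : A `<=` conv_hull A.
Proof. exact: sub_gen_smallest. Qed.

Lemma conv_hull_min (R : realType) n (A C : set 'rV[R]_n) :
  @convex_set R 'rV[R]_n C -> A `<=` C -> conv_hull A `<=` C.
Proof. exact: smallest_sub. Qed.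

Lemma convex_conv_hull (R : realType) n (A : set 'rV[R]_n) :
  @convex_set R 'rV[R]_n (conv_hull A).
Proof.
move=> x y t; rewrite !inE => Ax Ay C [cC AC].
by apply/set_mem/cC; apply/mem_set; [apply: Ax | apply: Ay].
Qed.

Lemma conv_hull0 (R : realType) n : conv_hull (set0 : set 'rV[R]_n) = set0.
Proof.
apply/seteqP; split=> //; apply: conv_hull_min => //.
Qed.

Lemma convex_preimage (R : realType) m n (f : {linear 'rV[R]_m -> 'rV[R]_n})
    (C : set 'rV[R]_n) :
  @convex_set R 'rV[R]_n C -> @convex_set R 'rV[R]_m (f @^-1` C).
Proof.
move=> cC x y t; rewrite !inE /= => Cx Cy.
rewrite /conv /= linearD !linearZ /=.
by apply/set_mem/(cC (f x) (f y) t); apply/mem_set.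
Qed.

Lemma convex_image (R : realType) m n (f : {linear 'rV[R]_m -> 'rV[R]_n})
    (C : set 'rV[R]_m) :
  @convex_set R 'rV[R]_m C -> @convex_set R 'rV[R]_n (f @` C).
Proof.
move=> cC x y t; rewrite !inE /= => -[a Ca <-] [b Cb <-].
exists (conv t (a : convex_lmodType 'rV[R]_m) b).
  by apply/set_mem/(cC a b t); apply/mem_set.
by rewrite /conv /= linearD !linearZ.
Qed.

Lemma conv_hull_image (R : realType) m n (f : {linear 'rV[R]_m -> 'rV[R]_n})
    (A : set 'rV[R]_m) :
  f @` conv_hull A = conv_hull (f @` A).
Proof.
apply/seteqP; split.
  move=> _ [x Ax <-]; move: x Ax.
  suff: conv_hull A `<=` f @^-1` conv_hull (f @` A) by [].
  apply: conv_hull_min => [|x Ax].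
    exact/convex_preimage/convex_conv_hull.
  by apply: sub_conv_hull; exists x.
apply: conv_hull_min; first exact/convex_image/convex_conv_hull.
by move=> _ [x Ax <-]; exists x => //; apply: sub_conv_hull.
Qed.

Lemma dot_conv (R : realType) n (u x y : 'rV[R]_n) (t : {i01 R}) :
  dot u (conv t (x : convex_lmodType 'rV[R]_n) y) =
  t%:inum * dot u x + (1 - t%:inum) * dot u y.
Proof. by rewrite dotDr !dotZr. Qed.

Lemma convex_halfspace (R : realType) n (u : 'rV[R]_n) m :
  @convex_set R 'rV[R]_n [set x | dot u x <= m].
Proof.
apply/convex_setW => x y; rewrite !inE /= => xm ym t t0 t1.
by rewrite inE /= dot_conv; nra.
Qed.

(** A point of the hull that maximises [dot u] can only be a combination of
    points of [S] that do. To see this without writing combinations, let [m] be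
    the maximum: the points [y] with [dot u y <= m] that lie in the hull of the
    maximisers as soon as [dot u y = m] form a convex set, which contains [S]
    and hence its hull. *)
Lemma conv_hull_face (R : realType) n (S : set 'rV[R]_n) (u : 'rV[R]_n) :
  [set x | conv_hull S x /\ forall y, conv_hull S y -> dot u y <= dot u x] =
  conv_hull [set x | S x /\ forall y, S y -> dot u y <= dot u x].
Proof.
set T := [set x | S x /\ _].
apply/seteqP; split=> [x [Sx xmax]|x Tx].
  pose m := dot u x.
  suff: conv_hull S `<=`
      [set y | dot u y <= m /\ (dot u y = m -> conv_hull T y)].
    by move=> /(_ x Sx)[_]; apply.
  apply: conv_hull_min => [|y Sy]; last first.
    have ym := xmax _ (sub_conv_hull Sy).
    split=> // ymE; apply: sub_conv_hull; split=> // z Sz.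
    by rewrite ymE; apply: xmax; apply: sub_conv_hull.
  apply/convex_setW => a b; rewrite !inE => -[am Ta] [bm Tb] t t0 t1.
  rewrite inE /= dot_conv; split; first nra.
  move=> tE.
  (* A proper average of two values at most [m] equals [m] only if both do. *)
  have : t%:num * (m - dot u a) + (1 - t%:num) * (m - dot u b) == 0.
    by apply/eqP; rewrite -[RHS](subrr m) -[X in _ = _ - X]tE; ring.
  rewrite paddr_eq0 ?mulr_ge0 ?subr_ge0 ?(ltW t1) // !mulf_eq0 !subr_eq0.
  rewrite (gt_eqF t0) (gt_eqF t1) /= => /andP[/eqP/esym /Ta aT /eqP/esym/Tb bT].
  by apply/set_mem/convex_conv_hull; apply/mem_set.
split.
  by move: x Tx; apply: sub_smallest2r => [|x []//]; apply: convex_conv_hull.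
have [z [Sz zmax]] : T !=set0.
  by apply/set0P/eqP => T0; move: Tx; rewrite T0 conv_hull0.
move=> y Sy; apply: (@le_trans _ _ (dot u z)).
  by move: y Sy; apply: conv_hull_min (@convex_halfspace _ _ _ _) _ => y /zmax.
rewrite -lerN2 -!dotNl; move: x Tx.
apply: conv_hull_min (@convex_halfspace _ _ _ _) _ => x [Sx xmax] /=.
by rewrite !dotNl lerN2 xmax.
Qed.

(** * Affine dimension *)

(** Among the subspaces that contain all differences, one of least dimension
    is contained in any other: otherwise intersecting the two would lower the
    dimension. *)
Lemma dim_exists (R : realType) n (A : set 'rV[R]_n) :
  A !=set0 -> exists2 d, (d <= n)%N & has_dim A d.
Proof.
move=> A0; pose spans (W : 'M[R]_n) :=
  forall x y, A x -> A y -> (x - y <= W)%MS.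
pose P (k : nat) := `[< exists2 W, \rank W = k & spans W >].
have exP : exists k, P k.
  exists n; apply/asboolP; exists 1%:M; first exact: mxrank1.
  by move=> x y _ _; apply: submx1.
case: (ex_minnP exP) => k /asboolP[U rU sU] kmin.
exists k; first by rewrite -rU rank_leq_row.
split=> //; exists U => // W; split=> [UW x y Ax Ay|sW].
  exact: submx_trans (sU _ _ Ax Ay) UW.
have rUW : (\rank U <= \rank (U :&: W)%MS)%N.
  rewrite rU; apply: kmin; apply/asboolP; exists (U :&: W)%MS => // x y Ax Ay.
  by rewrite sub_capmx sU // sW.
have /eqmxP UWE : (U :&: W == U)%MS.
  by rewrite -(mxrank_leqif_eq (capmxSl U W)).2 eqn_leq rUW mxrankS // capmxSl.
by rewrite -UWE capmxSr.
Qed.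

Lemma dim_unique (R : realType) n (A : set 'rV[R]_n) d d' :
  has_dim A d -> has_dim A d' -> d = d'.
Proof.
move=> [_ [U <- hU]] [_ [U' <- hU']].
apply/eqP; rewrite eqn_leq !mxrankS //.
  by apply/hU' => x y; apply: (hU U).1.
by apply/hU => x y; apply: (hU' U').1.
Qed.

(** For a subspace [W], each coset of [W] is convex, so differences of points
    of the hull stay in [W] if those of [A] do. *)
Lemma has_dim_conv_hull (R : realType) n (A : set 'rV[R]_n) d :
  has_dim (conv_hull A) d <-> has_dim A d.
Proof.
have ne : conv_hull A !=set0 <-> A !=set0.
  split=> [|[x Ax]]; last by exists x; apply: sub_conv_hull.
  by case=> x; have [->|/set0P//] := eqVneq A set0; rewrite conv_hull0.
have diff (W : 'M[R]_n) :
    (forall x y, conv_hull A x -> conv_hull A y -> (x - y <= W)%MS) <->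
    (forall x y, A x -> A y -> (x - y <= W)%MS).
  split=> [H x y Ax Ay|H]; first by apply: H; apply: sub_conv_hull.
  have cv (z : 'rV[R]_n) : @convex_set R 'rV[R]_n [set x | (x - z <= W)%MS].
    move=> x y t; rewrite !inE /= => xW yW.
    rewrite [X in (X <= _)%MS](_ : _ =
       t%:inum *: (x - z) + (1 - t%:inum) *: (y - z)).
      by rewrite addmx_sub // scalemx_sub.
    rewrite !scalerBr addrACA -opprD -scalerDl.
    by rewrite [_ + (1 - _)]addrC subrK scale1r.
  (* The two ends of a difference are moved into the hull one at a time. *)
  have H1 x y : conv_hull A x -> A y -> (x - y <= W)%MS.
    move=> Ax Ay; move: x Ax; apply: conv_hull_min (cv y) _ => x Ax.
    exact: H.
  move=> x y Ax Ay; rewrite -opprB eqmx_opp; move: y Ay.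
  apply: conv_hull_min (cv x) _ => y Ay /=.
  by rewrite -opprB eqmx_opp; apply: H1.
split=> -[/ne A0 [U rU hU]]; split=> //; exists U => // W.
  exact: iff_trans (hU W) (diff W).
exact: iff_trans (hU W) (iff_sym (diff W)).
Qed.

(** Only the differences of points of [A] need to be transformed linearly, so
    the lemma applies to a map [f] that is affine on [A] alone. *)
Lemma has_dim_image (R : realType) m n (f : 'rV[R]_m -> 'rV[R]_n)
    (L : 'M[R]_(m, n)) (A : set 'rV[R]_m) d :
  row_free L -> (forall x y, A x -> A y -> f x - f y = (x - y) *m L) ->
  has_dim (f @` A) d <-> has_dim A d.
Proof.
move=> Lfree fL.
have imp k : has_dim A k -> has_dim (f @` A) k.
  move=> [A0 [U <- hU]]; split; first exact: image_nonempty.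
  exists <<U *m L>>%MS; first by rewrite genmxE mxrankMfree.
  move=> W; rewrite genmxE.
  have preim l (X : 'M[R]_(l, m)) :
      (X *m L <= W)%MS = (X <= kermx (L *m cokermx W))%MS.
    by rewrite sub_kermx submxE -mulmxA.
  rewrite preim; apply: iff_trans (hU _) _; split=> H.
    by move=> _ _ [x Ax <-] [y Ay <-]; rewrite fL // preim H.
  by move=> x y Ax Ay; rewrite -preim -fL //; apply: H; [exists x|exists y].
(* Dimensions exist and are unique, so the converse follows. *)
split=> [fAd|]; last exact: imp.
have A0 : A !=set0 by case: fAd.1 => _ [x Ax _]; exists x.
have [k _ Ak] := dim_exists A0.
by rewrite (dim_unique fAd (imp _ Ak)).
Qed.

(** The directions of [F] and [J] are orthogonal complements: the second
    hypothesis makes them orthogonal, and the third one realises each vector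
    orthogonal to [J] as a direction of [F]. *)
Lemma has_dim_orth (R : realType) n (J F : set 'rV[R]_n) (q0 : 'rV[R]_n) d :
  F q0 ->
  (forall q q' p p', F q -> F q' -> J p -> J p' -> dot (q - q') (p - p') = 0) ->
  (forall v, (forall p p', J p -> J p' -> dot v (p - p') = 0) ->
     exists2 e : R, e != 0 & F (q0 + e *: v)) ->
  has_dim J d -> has_dim F (n - d).
Proof.
move=> Fq0 orth open [_ [U <- hU]]; split; first by exists q0.
exists (kermx U^T); first by rewrite mxrank_ker mxrank_tr.
move=> W; split=> [kW x y Fx Fy|FW].
  apply: submx_trans kW; rewrite sub_kermx -trmx_eq0 trmx_mul trmxK -sub_kermx.
  apply/hU => p p' Jp Jp'; rewrite sub_kermx; apply/eqP/dot_eq0.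
  by rewrite dotC orth.
apply/rV_subP => v; rewrite sub_kermx => /eqP vU.
have [p p' Jp Jp'|e e0 Fv] := open v.
  have /submxP[D ->] : (p - p' <= U)%MS by apply: (hU U).1.
  by rewrite /dot trmx_mul mulmxA vU mul0mx mxE.
rewrite -(eqmx_scale _ e0); have := FW _ _ Fv Fq0.
by rewrite addrAC subrr add0r.
Qed.

(** * Points minimising a tilted height function *)

(** The height at which the graph of the affine function of slope [q] through
    the lifted point [(p, s p)] crosses the vertical axis. *)
Definition tilt (R : realType) n (s : 'rV[R]_n -> R) (q p : 'rV[R]_n) : R :=
  s p - dot q p.

(** The points of [V] whose lifts lie on the highest plane of slope [q] that
    passes below all lifted points. *)
Definition tilt_argmin (R : realType) n (s : 'rV[R]_n -> R) (V : set 'rV[R]_n)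
    (q : 'rV[R]_n) : set 'rV[R]_n :=
  [set p | V p /\ forall p', V p' -> tilt s q p <= tilt s q p'].

Lemma tilt_argminP (R : realType) n (s : 'rV[R]_n -> R) (V : set 'rV[R]_n)
    q p i : tilt_argmin s V q i -> V p ->
  tilt_argmin s V q p <-> tilt s q p <= tilt s q i.
Proof.
move=> [Vi mini] Vp; split=> [[_]|pi]; first exact.
by split=> // p' /mini; apply: le_trans.
Qed.

Lemma tilt_argmin_eq (R : realType) n (s : 'rV[R]_n -> R) (V : set 'rV[R]_n)
    q p p' : tilt_argmin s V q p -> tilt_argmin s V q p' ->
  s p - s p' = dot q (p - p').
Proof.
move=> [Vp pmin] [Vp' p'min]; apply/eqP; rewrite dotBr eq_le.
have := pmin _ Vp'; have := p'min _ Vp; rewrite /tilt => h1 h2.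
by apply/andP; split; lra.
Qed.

Lemma tilt_midpoint (R : realType) n (s : 'rV[R]_n -> R) q q' p :
  tilt s (2^-1 *: (q + q')) p = 2^-1 * (tilt s q p + tilt s q' p).
Proof. by rewrite /tilt dotZl dotDl; field. Qed.

Lemma tiltD (R : realType) n (s : 'rV[R]_n -> R) q e v p :
  tilt s (q + e *: v) p = tilt s q p - e * dot v p.
Proof. by rewrite /tilt dotDl dotZl; ring. Qed.

(** * Generic slopes and the dimension of a power face *)

(** A slope in the relative interior of [F]. If [p] is not a minimiser for
    some slope of [F], then it is not one for the midpoint of that slope and any
    other slope of [F], since on [F] the points of [I] are always minimisers
    and the excess of [p] over them is affine and nonnegative. Repeating this
    for each of the finitely many points of [V] leaves only those that are
    minimisers for all slopes of [F]. *)
Lemma generic_slope (R : realType) n (s : 'rV[R]_n -> R) (V I : set 'rV[R]_n) :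
  finite_set V -> I !=set0 ->
  let F := [set q | I `<=` tilt_argmin s V q] in F !=set0 ->
  exists2 q0, F q0 &
    [set p | V p /\ F `<=` [set q | tilt_argmin s V q p]] = tilt_argmin s V q0.
Proof.
move=> /finite_seqP[l Vl] [i Ii] F [q1 Fq1].
suff [q0 Fq0 q0P] : exists2 q0, F q0 & forall p, p \in l ->
    tilt_argmin s V q0 p -> F `<=` [set q | tilt_argmin s V q p].
  exists q0 => //; apply/seteqP; split=> [p [_ /(_ _ Fq0)]//|p q0p].
  split; first by case: q0p.
  by apply: q0P => //; case: q0p; rewrite Vl.
have {Vl} : {subset l <= V} by move=> p pl; rewrite inE Vl.
elim: l => [|p l IHl] lV; first by exists q1.
have Vp : V p by apply/set_mem/lV; rewrite mem_head.
have [q Fq qP] : exists2 q, F q & forall p, p \in l ->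
    tilt_argmin s V q p -> F `<=` [set q | tilt_argmin s V q p].
  by apply: IHl => x xl; apply: lV; rewrite inE xl orbT.
have [pF|/existsNP[q' /not_implyP[Fq' q'p]]] :=
  pselect (F `<=` [set q | tilt_argmin s V q p]).
  exists q => // x; rewrite inE => /orP[/eqP->//|]; exact: qP.
have midF j : I j -> tilt_argmin s V (2^-1 *: (q + q')) j.
  move=> Ij; have [Vj jq] := Fq _ Ij; have [_ jq'] := Fq' _ Ij.
  split=> // p' Vp'; rewrite !tilt_midpoint.
  by have := jq _ Vp'; have := jq' _ Vp'; lra.
exists (2^-1 *: (q + q')) => // x xl midx.
have Vx := midx.1.
have [_ /(_ _ Vx) qix] := Fq _ Ii; have [_ /(_ _ Vx) q'ix] := Fq' _ Ii.
have := (tilt_argminP (midF _ Ii) Vx).1 midx; rewrite !tilt_midpoint => mid.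
move: xl; rewrite inE => /orP[/eqP xp|xl].
  case: q'p; rewrite -xp; apply/(tilt_argminP (Fq' _ Ii) Vx); lra.
apply: qP => //; apply/(tilt_argminP (Fq _ Ii) Vx); lra.
Qed.

(** Finitely many inequalities, affine in [e], each of them either strict at
    [e = 0] or identically an equality, still hold for some positive [e]. *)
Lemma small_perturbation (R : realType) (T : eqType) (l : seq T)
    (a b : T -> R) :
  (forall x, x \in l -> 0 < a x \/ (a x = 0 /\ b x = 0)) ->
  exists2 e, 0 < e & forall x, x \in l -> e * b x <= a x.
Proof.
elim: l => [|x l IHl] ab; first by exists 1.
have [e e0 el] : exists2 e, 0 < e & forall x, x \in l -> e * b x <= a x.
  by apply: IHl => y yl; apply: ab; rewrite inE yl orbT.
have shrink e' y : 0 < e' -> e' <= e -> y \in l -> e' * b y <= a y.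
  move=> e'0 e'e yl; have := el _ yl.
  have : 0 <= a y by have [||[-> _]] := ab y; rewrite ?inE ?yl ?orbT // => /ltW.
  have [b0|b0] := leP 0 (b y); nra.
have [|ax|[ax bx]] := ab x; first by rewrite mem_head.
  (* Adding [1] keeps the denominator positive when [b x = 0]. *)
  pose c := `|b x| + 1.
  have c0 : 0 < c by rewrite ltr_wpDl.
  have e'0 : 0 < Num.min e (a x / c) by rewrite lt_min e0 divr_gt0.
  exists (Num.min e (a x / c)) => // y; rewrite inE => /orP[/eqP->|yl].
    apply: (@le_trans _ _ (Num.min e (a x / c) * c)).
      rewrite ler_pM2l //; apply: le_trans (ler_norm _) _.
      by rewrite lerDl.
    by rewrite -ler_pdivlMr // ge_min lexx orbT.
  by apply: shrink => //; rewrite ge_min lexx.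
exists e => // y; rewrite inE => /orP[/eqP->|]; last exact: el.
by rewrite ax bx mulr0.
Qed.

(** Moving [q0] along a vector orthogonal to the differences of minimisers
    keeps their tilted heights equal, and for a short move the other points of
    [V] stay above them. *)
Lemma has_dim_slopes (R : realType) n (s : 'rV[R]_n -> R) (V I : set 'rV[R]_n)
    q0 d :
  finite_set V -> I !=set0 ->
  let F := [set q | I `<=` tilt_argmin s V q] in F q0 ->
  [set p | V p /\ F `<=` [set q | tilt_argmin s V q p]] = tilt_argmin s V q0 ->
  has_dim (tilt_argmin s V q0) d -> has_dim F (n - d).
Proof.
move=> /finite_seqP[l Vl] [i Ii] F Fq0 q0J.
have FJ q p : F q -> tilt_argmin s V q0 p -> tilt_argmin s V q p.
  by move=> Fq; rewrite -q0J => -[_]; apply.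
apply: has_dim_orth (Fq0) _ _ => [q q' p p' Fq Fq' Jp Jp'|v vJ].
  rewrite dotBl -(tilt_argmin_eq (FJ _ _ Fq Jp) (FJ _ _ Fq Jp')).
  by rewrite -(tilt_argmin_eq (FJ _ _ Fq' Jp) (FJ _ _ Fq' Jp')) subrr.
have Ji := Fq0 _ Ii.
(* The first function is the excess of [p] over the minimum; the second one is
   the rate at which this excess drops along [v]. *)
have [p pl|e e0 eP] := @small_perturbation R _ l
    (fun p => tilt s q0 p - tilt s q0 i) (fun p => dot v (p - i)).
  have Vp : V p by rewrite Vl.
  have [Jp|Jp] := pselect (tilt_argmin s V q0 p).
    right; rewrite vJ //; split=> //; apply/eqP.
    by rewrite subr_eq0 eq_le Ji.2 ?Jp.2 //; apply: Ji.1.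
  left; rewrite subr_gt0 ltNge; apply/negP.
  by move=> /(tilt_argminP Ji Vp).
exists e; first by rewrite gt_eqF.
move=> j Ij; have Jj := Fq0 _ Ij; split; first exact: Jj.1.
move=> p; rewrite Vl => /eP.
have := vJ _ _ Jj Ji; have := (tilt_argminP Ji Jj.1).1 Jj.
rewrite !tiltD !dotBr => h1 h2 h3; nra.
Qed.

(** * The two complexes as a regular subdivision *)

(** The [d]-dimensional cells of the regular subdivision of [V] induced by the
    heights [s]: the common description of the two complexes. *)
Definition regular_cells (R : realType) (V : set 'rV[R]_2)
    (s : 'rV[R]_2 -> R) (d : nat) : set (set 'rV[R]_2) :=
  [set Q | exists2 q, has_dim (tilt_argmin s V q) d
                    & Q = conv_hull (tilt_argmin s V q)].

Lemma proj_lift (R : realType) (s : 'rV[R]_2 -> R) p :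
  Defs.proj (Defs.lift s p) = p.
Proof. exact: row_mxKl. Qed.

Lemma dot_lift (R : realType) (s : 'rV[R]_2 -> R) u p :
  dot u (Defs.lift s p) = dot (Defs.proj u) p + zcoord u * s p.
Proof.
rewrite /dot -{1}(hsubmxK u) tr_row_mx mul_row_col mxE; congr (_ + _).
by rewrite tr_scalar_mx mul_mx_scalar mxE mulrC.
Qed.

(** The normal [u] is a positive multiple of [(q, -1)] with
    [q = (- zcoord u)^-1 *: proj u], and maximising [dot q p - s p] means
    minimising [s p - dot q p]. *)
Lemma supporting_slope (R : realType) (V : set 'rV[R]_2) (s : 'rV[R]_2 -> R) u :
  zcoord u < 0 ->
  [set x | (Defs.lift s @` V) x /\
           forall y, (Defs.lift s @` V) y -> dot u y <= dot u x] =
  Defs.lift s @` tilt_argmin s V ((- zcoord u)^-1 *: Defs.proj u).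
Proof.
set h := - zcoord u => z0.
have h0 : 0 < h by rewrite oppr_gt0.
have zE : zcoord u = - h by rewrite opprK.
clearbody h.
have dotE p : dot u (Defs.lift s p) = - h * tilt s (h^-1 *: Defs.proj u) p.
  by rewrite dot_lift zE /tilt dotZl; field; rewrite gt_eqF.
have le_tilt p p' : (dot u (Defs.lift s p) <= dot u (Defs.lift s p')) =
    (tilt s (h^-1 *: Defs.proj u) p' <= tilt s (h^-1 *: Defs.proj u) p).
  by rewrite !dotE ler_nM2l // oppr_lt0.
apply/seteqP; split=> [_ [[p Vp <-] pmax]|_ [p [Vp pmin] <-]].
  by exists p => //; split=> // p' Vp'; rewrite -le_tilt; apply: pmax; exists p'.
by split=> [|_ [p' Vp' <-]]; [exists p | rewrite le_tilt; apply: pmin].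
Qed.

(** All minimisers have equal tilted height, so on them [s] is affine of
    slope [q] and the lift is injective and affine. *)
Lemma has_dim_lift_argmin (R : realType) (V : set 'rV[R]_2)
    (s : 'rV[R]_2 -> R) q d :
  has_dim (Defs.lift s @` tilt_argmin s V q) d <->
  has_dim (tilt_argmin s V q) d.
Proof.
apply: (@has_dim_image _ _ _ _ (row_mx 1%:M q^T)) => [|x y Mx My].
  apply/row_freeP; exists (col_mx 1%:M 0).
  by rewrite mul_row_col mulmx1 mulmx0 addr0.
rewrite mul_mx_row mulmx1 /Defs.lift opp_row_mx add_row_mx; congr row_mx.
rewrite -raddfB /= (tilt_argmin_eq Mx My) dotC.
by rewrite [RHS]mx11_scalar.
Qed.

(** The normals [(q, -1)] reach every slope, and projecting commutes with
    taking hulls. *)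
Lemma lower_hull_cellsE (R : realType) (V : set 'rV[R]_2)
    (s : 'rV[R]_2 -> R) d :
  lower_hull_cells V s d = regular_cells V s d.
Proof.
have projhull q : Defs.proj @` conv_hull (Defs.lift s @` tilt_argmin s V q) =
    conv_hull (tilt_argmin s V q).
  rewrite (conv_hull_image (lsubmx : {linear 'rV[R]_(2 + 1) -> 'rV[R]_2})).
  congr conv_hull; rewrite image_comp; apply: eq_image_id => x _.
  exact: proj_lift.
apply/seteqP; split=> Q.
  move=> [F [Fd [u [_ FE] z0]] ->]; move: Fd.
  rewrite FE conv_hull_face supporting_slope // => Fd.
  exists ((- zcoord u)^-1 *: Defs.proj u); last exact: projhull.
  by apply/has_dim_lift_argmin/has_dim_conv_hull.
move=> [q qd ->]; exists (conv_hull (Defs.lift s @` tilt_argmin s V q)).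
  split; first by apply/has_dim_conv_hull/has_dim_lift_argmin.
  have z1 : zcoord (row_mx q (-1)%:M) = -1.
    by rewrite /zcoord row_mxKr mxE.
  have z0 : zcoord (row_mx q (-1)%:M) < 0 by rewrite z1 ltrN10.
  exists (row_mx q (-1)%:M) => //; split.
    by apply: contraTneq z0 => ->; rewrite /zcoord linear0 mxE ltxx.
  rewrite conv_hull_face supporting_slope // z1 opprK invr1 scale1r.
  by rewrite /Defs.proj row_mxKl.
by rewrite projhull.
Qed.

(** With these weights the power of [q] with respect to [p] is
    [sqnorm q + 2 * tilt s q p], where the first term does not depend on [p]. *)
Lemma power_cellE (R : realType) (V : set 'rV[R]_2) (s w : 'rV[R]_2 -> R) p :
  (forall p, V p -> w p = sqnorm p - 2 * s p) -> V p ->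
  power_cell V w p = [set q | tilt_argmin s V q p].
Proof.
move=> wE Vp; have powE q p' : V p' ->
    sqnorm (q - p') - w p' = sqnorm q + 2 * tilt s q p'.
  move=> Vp'; rewrite wE // /sqnorm /tilt dotBl !dotBr (dotC p' q); ring.
apply/seteqP; split=> [q qp|q [_ qp] p' Vp'].
  by split=> // p' Vp'; have := qp _ Vp'; rewrite !powE //; lra.
by rewrite !powE //; have := qp _ Vp'; lra.
Qed.

(** For a generic slope [q0] of a power face [F], the vertices dual to [F] are
    the minimisers of slope [q0], and [F] has dimension [2 - d] exactly when
    these have dimension [d]. The bound [d <= 2] makes the truncated difference
    [2 - d] determine [d]. *)
Lemma dual_cellsE (R : realType) (V : set 'rV[R]_2) (s w : 'rV[R]_2 -> R) d :
  (forall p, V p -> w p = sqnorm p - 2 * s p) -> finite_set V -> (d <= 2)%N ->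
  dual_cells V w d = regular_cells V s d.
Proof.
move=> wE Vfin d2.
have cellE p : V p -> power_cell V w p = [set q | tilt_argmin s V q p].
  exact: power_cellE.
have faceE I : I `<=` V -> \bigcap_(p in I) power_cell V w p =
    [set q | I `<=` tilt_argmin s V q].
  move=> IV; apply/seteqP; split=> q qI p Ip; have := qI p Ip.
    by rewrite cellE //; apply: IV.
  by rewrite cellE //; apply: IV.
have dualE F : dual_cell V w F =
    conv_hull [set p | V p /\ F `<=` [set q | tilt_argmin s V q p]].
  congr conv_hull; apply/seteqP; split=> p [Vp Fp]; split=> //.
    by rewrite -cellE.
  by rewrite cellE.
apply/seteqP; split=> Q.
  move=> [F [[I [IV I0 FE]] Fd ->]]; rewrite {}FE faceE // in Fd *.
  have [q0 Fq0 q0E] := generic_slope Vfin I0 Fd.1.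
  exists q0; last by rewrite dualE q0E.
  have [d' d'2 q0d'] :
      exists2 d', (d' <= 2)%N & has_dim (tilt_argmin s V q0) d'.
    by apply: dim_exists; case: I0 => i Ii; exists i; apply: Fq0.
  have Fd' := has_dim_slopes Vfin I0 Fq0 q0E q0d'.
  have dd' := dim_unique Fd Fd'.
  by rewrite -(subKn d2) dd' subKn.
(* Conversely, the minimisers of slope [q] are dual to the face of all slopes
   that share them, and [q] is generic in that face. *)
move=> [q qd ->]; have J0 := qd.1; set J := tilt_argmin s V q in qd J0 *.
have JV : J `<=` V by move=> p [].
pose F := [set q' | J `<=` tilt_argmin s V q'].
have FJ : [set p | V p /\ F `<=` [set q | tilt_argmin s V q p]] = J.
  apply/seteqP; split=> [p [_]|p Jp]; first exact.
  by split=> [|q']; [apply: JV | apply].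
exists F; split; last by rewrite dualE FJ.
  by exists J; split=> //; rewrite faceE.
exact: has_dim_slopes FJ qd.
Qed.

Theorem proposition4p5 (R : realType) (Omega : set 'rV[R]_2)
    (s : 'rV[R]_2 -> R) (V : set 'rV[R]_2) (w : 'rV[R]_2 -> R)
    (s_convex : convex_on Omega s)
    (V_finite : finite_set V) (V_sub : V `<=` Omega)
    (w_def : forall p, V p -> w p = p 0 0 ^+ 2 + p 0 1 ^+ 2 - 2 * s p) :
  (forall d : nat, (d <= 2)%N -> dual_cells V w d = lower_hull_cells V s d) /\
  (forall T : set (set 'rV[R]_2),
     weighted_delaunay V w T <-> hull_triangulation V s T).
Proof.
have wE p : V p -> w p = sqnorm p - 2 * s p.
  move=> /w_def ->; rewrite /sqnorm /dot mxE big_ord_recl big_ord1 !mxE !expr2.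
  by rewrite (_ : lift ord0 ord0 = 1) //; apply: val_inj.
have cellsE d : (d <= 2)%N -> dual_cells V w d = lower_hull_cells V s d.
  by move=> d2; rewrite lower_hull_cellsE; apply: dual_cellsE.
by split=> // T; rewrite /weighted_delaunay /hull_triangulation cellsE.
Qed.
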